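(* Let $E$ be a Fréchet space, $[a,b]\subset\mathbb{R}$, and let $f,\gamma\colon[a,b]\to E'$ be weak-$*$ continuous. The following are equivalent: (a) $\displaystyle\int_a^b\bigl[f(t)(\mu(t))+\gamma(t)(\mu'(t))\bigr]\,dt=0$ for every $\mu\in C^{\infty}([a,b],E)$ with $\operatorname{supp}\mu\subset(a,b)$; (b) $\gamma$ is weak-$*$ $C^{1}$ with $\frac{d}{dt}\bigl[\gamma(t)(y)\bigr]=f(t)(y)$ for every $y\in E$ (equivalently, $\gamma(t)(y)=\gamma(a)(y)+\int_a^t f(s)(y)\,ds$ for all $t\in[a,b]$ and all $y\in E$).
   Context: $E'$ denotes the continuous dual of the (real) Fréchet space $E$. A map $\ell\colon J\to E'$ ($J\subset\mathbb{R}$ an interval) is called weak-$*$ continuous (resp. weak-$*$ $C^1$) if the scalar function $t\mapsto\ell(t)(y)$ is continuous (resp. $C^1$) for each $y\in E$. *)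

(* Defs.v *)
From HB Require Import structures.
From mathcomp Require Import all_boot all_order all_algebra.
From mathcomp Require Import all_classical all_reals all_analysis.
Set Implicit Arguments.
Unset Strict Implicit.
Unset Printing Implicit Defensive.
Import Order.TTheory GRing.Theory Num.Theory.
Import numFieldNormedType.Exports.
Local Open Scope classical_set_scope.
Local Open Scope ring_scope.

(* In a [tvsType] nothing relates the uniformity to the vector space structure
   beyond inducing the right topology.  [frechet_sub_unif_continuous] forces it
   to be the translation-invariant one, so that [cauchy] below is the usual
   notion of Cauchy filter in a topological vector space.  A Hausdorff uniform
   space is metrizable exactly when its uniformity is countably generated. *)
HB.mixin Record Tvs_isFrechet (R : realType) E & Tvs R E := {
  frechet_sub_unif_continuous : unif_continuous (fun x : E * E => x.1 - x.2) ;
  frechet_hausdorff : hausdorff_space E ;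
  frechet_countable_uniformity : countable_uniformity E ;
  frechet_cauchy_cvg : forall F : set_system E,
    ProperFilter F -> cauchy F -> exists l : E, F --> l
}.

#[short(type="frechetType")]
HB.structure Definition Frechet (R : realType) :=
  {E of Tvs R E & Tvs_isFrechet R E}.

Record dual (R : realType) (E : tvsType R) := Dual {
  dual_val :> {linear E -> R^o} ;
  dual_continuous : continuous dual_val
}.

(* Differentiation relative to a subset of the line, one-sided at the endpoints
   of an interval.  For [t] in [A] everything depends only on [u] restricted to
   [A], so a total function stands for a function defined on [A].  The library's
   [derive1] is two-sided and restricted to normed codomains. *)
Section derivative_on.
Context (R : realType) (E : tvsType R).
Implicit Types (A : set R) (u : R -> E).

Definition diff_quot u (t s : R) : E := (s - t)^-1 *: (u s - u t).

Definition derivable_on A u :=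
  forall t, A t -> exists l : E, diff_quot u t @ within A t^' --> l.

(* The library's [lim] with default value 0: a [tvsType] is not pointed. *)
Definition derive_on A u (t : R) : E :=
  xget 0 [set l | diff_quot u t @ within A t^' --> l].

Definition C1_on A u :=
  derivable_on A u /\ {within A, continuous (derive_on A u)}.

Definition smooth_on A u :=
  forall n, derivable_on A (iter n (derive_on A) u).

Definition supp_on A u : set R := closure (A `&` [set t | u t != 0]).

End derivative_on.

Definition weak_star_continuous (R : realType) (E : tvsType R) (J : set R)
    (l : R -> dual E) :=
  forall y : E, {within J, continuous (fun t => l t y)}.

Definition weak_star_C1 (R : realType) (E : tvsType R) (J : set R)
    (l : R -> dual E) :=
  forall y : E, C1_on J (fun t => l t y).

(* Main.v *)
Require Import Defs.
From mathcomp Require Import all_boot all_order all_algebra.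
From mathcomp Require Import all_classical all_reals all_analysis.
From mathcomp Require Import ring lra.
Set Implicit Arguments.
Unset Strict Implicit.
Unset Printing Implicit Defensive.
Import Order.TTheory GRing.Theory Num.Theory.
Import numFieldNormedType.Exports.
Local Open Scope classical_set_scope.
Local Open Scope ring_scope.

(* From the derivative condition to the vanishing integral: a weak-* continuous
   curve on [a,b] is pointwise bounded, hence equicontinuous by the
   Banach-Steinhaus theorem (Baire category in E).  Equicontinuity gives the
   product rule for t |-> gamma(t)(mu(t)), whose derivative is the integrand, and
   mu vanishes at both endpoints.

   Conversely, testing with mu = phi y for scalar phi and fixed y reduces the
   claim to the lemma of du Bois-Reymond for g = gamma(.)(y), with F a primitive
   of f(.)(y): if h = g - F took two values separated by m, choose phi as a
   difference of two smooth steps, increasing only where h > m and decreasing only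
   where h < m; integrating by parts gives int (h - m) phi' = 0 although the
   integrand is nonnegative and somewhere positive. *)

(** * Limits of sums and scalar multiples in a topological vector space *)

Section tvs_limits.
Context (R : realType) (E : tvsType R) (T : Type) (F : set_system T).
Context {FF : Filter F}.

Lemma tvs_cvgD (u v : T -> E) (x y : E) :
  u @ F --> x -> v @ F --> y -> u t + v t @[t --> F] --> x + y.
Proof. by apply: continuous2_cvg; exact: (@tvs.add_continuous E (x, y)). Qed.

Lemma tvs_cvgZ (k : T -> R) (u : T -> E) (c : R) (x : E) :
  k @ F --> c -> u @ F --> x -> k t *: u t @[t --> F] --> c *: x.
Proof.
by apply: continuous2_cvg; exact: (@tvs.scale_continuous R E (c, x)).
Qed.

End tvs_limits.

(** * Baire category and Banach-Steinhaus in a Fréchet space *)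

Section uniform_boundedness.
Context (R : realType) (E : frechetType R).

(** Nested neighbourhoods are chosen, the closure of each new one lying in the previous one and in
    [D n]. Controlled by a countable base [f] of entourages, their centres form a Cauchy sequence,
    and its limit lies in all the closures. *)
Lemma frechet_baire (D : nat -> set E) :
  (forall n, open (D n)) -> (forall n, dense (D n)) ->
  exists x, forall n, D n x.
Proof.
move=> oD dD.
have /countable_uniformityP[f fsub fent] :=
  @frechet_countable_uniformity R E.
(* A pair [(x, A)] stands for the neighbourhood [xsection A x] of [x]; each step
   shrinks it into the next open dense set. *)
have step (np : nat * (E * set (E * E))) : exists q : E * set (E * E),
    entourage np.2.2 -> [/\ entourage q.2, q.2 `<=` f np.1 &
      closure (xsection q.2 q.1) `<=` xsection np.2.2 np.2.1 `&` D np.1].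
  case: np => n [x A] /=; have [eA|] := pselect (entourage A); last first.
    by move=> nA; exists (x, A).
  have [oI Ix] := open_nbhs_entourage x eA.
  have [||y [Iy Dy]] := dD n (xsection A x)°; [by exists x|by []|].
  have : nbhs y ((xsection A x)° `&` D n).
    by apply: open_nbhs_nbhs; split; [exact: openI|].
  rewrite -nbhs_entourageE => -[B eB Bsub].
  exists (y, split_ent B `&` f n) => _ /=; split.
  - by apply: filterI => //; exact: entourage_split_ent.
  - by move=> ? [].
  - apply: (@subset_trans _ (closure (xsection (split_ent B) y))).
      by apply: closureS; rewrite xsectionI; exact: subIsetl.
    apply: (subset_trans (ent_closure eB)).
    apply: (subset_trans Bsub).
    by move=> z [Iz Dz]; split => //; exact: interior_subset.
have [g gP] := choice step.
pose s := fix s n : E * set (E * E) :=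
  if n is m.+1 then g (m, s m) else (0, setT).
have sE n : entourage (s n).2.
  by elim: n => [|n IH] /=; [exact: entourageT|case: (gP (n, s n) IH)].
have sP n : closure (xsection (s n.+1).2 (s n.+1).1) `<=`
    xsection (s n).2 (s n).1 `&` D n.
  by case: (gP (n, s n) (sE n)).
have sf n : (s n.+1).2 `<=` f n by case: (gP (n, s n) (sE n)).
have snest n k : xsection (s (n + k)%N).2 (s (n + k)%N).1 `<=`
    xsection (s n).2 (s n).1.
  elim: k => [|k IH]; first by rewrite addn0.
  rewrite addnS; apply: subset_trans IH.
  by move=> z /subset_closure /sP [].
have sin n m : (n <= m)%N -> xsection (s n).2 (s n).1 (s m).1.
  move=> /subnKC <-; apply: snest; apply/xsectionP.
  exact: entourage_refl.
pose x n := (s n).1.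
have [|l xl] := @frechet_cauchy_cvg R E (x @ \oo) _.
  move=> A eA.
  (* Two points of the neighbourhood [S] are both [f N]-close to its centre. Taking [f N] inside a
     symmetrized half of [A] makes them [A]-close to each other. *)
  have [N fN] := fsub _ (entourage_invI (entourage_split_ent eA)).
  pose S := xsection (s N.+1).2 (s N.+1).1.
  exists (S, S).
    by split; exists N.+1 => // m /= /sin.
  move=> [y z] [/= /xsectionP /sf /fN [_ Sy] /xsectionP /sf /fN [Sz _]].
  by apply: (entourage_split (s N.+1).1).
exists l => n.
have /sP[] // : closure (xsection (s n.+1).2 (s n.+1).1) l.
move=> B /xl [M _ MB]; exists (x (maxn M n.+1)); split.
  by apply: sin; rewrite leq_maxr.
by apply: MB; rewrite /= leq_maxl.
Qed.

(** If every open set [D n] were dense, a common point would contradict the pointwise bound. So some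
    [D n] misses a nonempty open [O], on which the family is bounded by [n]; translation and scaling
    carry this bound to 0. *)
Lemma uniform_boundedness (J : set R) (u : R -> dual E) :
  (forall y, exists M : R, forall t, J t -> `|u t y| <= M) ->
  forall e : R, 0 < e -> \forall y \near (0 : E), forall t, J t -> `|u t y| < e.
Proof.
move=> ub e e0.
pose D (n : nat) := [set y : E | exists2 t, J t & n%:R < `|u t y|].
have oD n : open (D n).
  rewrite openE => y [t Jt nt].
  have /cvg_norm /cvgr_gt/(_ _ nt) := @dual_continuous _ _ (u t) y.
  by apply: filterS => z nz; exists t.
have [dD|/existsNP[n nD]] := pselect (forall n, dense (D n)).
  have [x xD] := frechet_baire oD dD.
  have [M xM] := ub x.
  have [t Jt] := xD (Num.bound `|M|).
  rewrite ltNge => /negP[]; apply: (le_trans (xM t Jt)).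
  by apply: (le_trans (ler_norm _)); rewrite ltW// archi_boundP.
case/existsNP : nD => O /not_implyP [] [x Ox] /not_implyP [oO].
move=> /forallNP OD.
have bO y : O y -> forall t, J t -> `|u t y| <= n%:R.
  move=> Oy t Jt; rewrite leNgt; apply/negP => nt.
  by apply: (OD y); split => //; exists t.
(* A difference of two points of [O] has values at most [2 * n]. Dividing by [n.+1] keeps [c] finite
   for [n = 0] and makes the final bound strict. *)
pose c : R := e / (2 * n.+1%:R).
have c0 : 0 < c by rewrite divr_gt0// mulr_gt0// ltr0n.
have : \forall y \near (0 : E), O (c^-1 *: y + x).
  have : (c^-1 *: y + x) @[y --> (0 : E)] --> c^-1 *: (0 : E) + x.
    apply: tvs_cvgD; last exact: cvg_cst.
    apply: tvs_cvgZ; [exact: cvg_cst|exact: cvg_id].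
  rewrite scaler0 add0r.
  by apply; apply: open_nbhs_nbhs.
apply: filterS => y Oy t Jt.
have -> : y = c *: ((c^-1 *: y + x) - x).
  by rewrite addrK scalerA divff ?scale1r ?gt_eqF.
rewrite linearZ linearB /= normrZ gtr0_norm//.
have h : `|u t (c^-1 *: y + x) - u t x| <= 2 * n%:R.
  rewrite (le_trans (ler_normB _ _))// mulr_natl mulr2n.
  by rewrite lerD ?bO.
apply: (@le_lt_trans _ _ (c * (2 * n%:R))); first by rewrite ler_pM2l.
rewrite /c mulrAC ltr_pdivrMr ?mulr_gt0 ?ltr0n// ltr_pM2l// ltr_pM2l//.
by rewrite ltr_nat.
Qed.

End uniform_boundedness.

(** * Difference quotients relative to a segment and two-sided derivatives *)

Section derivative_on_theory.
Context (R : realType).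

(** Carathéodory's slope function is the difference quotient completed by the value [l] at [t]; its
    continuity at [t] is the punctured limit. *)
Lemma is_derive_diff_quot (F : R -> R) (t l : R) :
  is_derive t 1 F l <-> diff_quot (F : R -> R^o) t s @[s --> t^'] --> l.
Proof.
split=> [/is_derive1_caratheodory[g [gE gc gt]]|dF].
  have : g s @[s --> t^'] --> l by rewrite -gt; apply/continuous_withinNx.
  apply: cvg_trans; apply: near_eq_cvg; near=> s.
  rewrite /diff_quot gE /GRing.scale/= mulrCA mulVf ?mulr1// subr_eq0.
  by near: s; exact: nbhs_dnbhs_neq.
apply/is_derive1_caratheodory.
exists (fun s => if s == t then l else diff_quot (F : R -> R^o) t s); split.
- move=> s; case: eqVneq => [->|st]; first by rewrite !subrr mulr0.
  by rewrite /diff_quot /GRing.scale/= mulrC mulrA mulfV ?mul1r// subr_eq0.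
- apply/continuous_withinNx; rewrite eqxx; apply: cvg_trans dF.
  apply: near_eq_cvg; near=> s; rewrite ifF//; apply/negbTE.
  by near: s; exact: nbhs_dnbhs_neq.
- by rewrite eqxx.
Unshelve. all: by end_near. Qed.

Lemma is_derive_inj (F : R -> R) (t l l' : R) :
  is_derive t 1 F l -> is_derive t 1 F l' -> l = l'.
Proof. by move=> [_ <-] [_ <-]. Qed.

Lemma within_itv_dnbhs (a b t : R) : t \in `]a, b[ -> within `[a, b] t^' = t^'.
Proof.
move=> tab; have abt : \forall s \near t^', `[a, b]%classic s.
  apply: cvg_within; apply: (@filterS _ _ _ `]a, b[%classic).
    by move=> s; exact: subset_itv_oo_cc.
  by apply: open_nbhs_nbhs; split; [exact: itv_open|exact: tab].
apply/seteqP; split=> P PP; last first.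
  by apply: filterS PP => s ? _.
by apply: filterS2 abt PP => s As; exact.
Qed.

(** Gives uniqueness of one-sided limits, hence a determined [derive_on] at the endpoints too. The
    segment accumulates at [t] from the right if [t < b], from the left otherwise. *)
Lemma within_itv_proper (a b t : R) : a < b -> t \in `[a, b] ->
  ProperFilter (within `[a, b] t^').
Proof.
rewrite in_itv/= => ab /andP[ta tb]; apply: Build_ProperFilter_ex => P.
rewrite /within /= near_withinE => PP.
have [tb'|bt] := ltP t b.
- have : \forall s \near t^'+, P s.
    near=> s; have ts : t < s by near: s; exact: nbhs_right_gt.
    have sb : s <= b by near: s; exact: nbhs_right_le.
    have : s != t -> `[a, b]%classic s -> P s.
      by near: s; exact: cvg_within PP.
    by apply; rewrite ?gt_eqF//= in_itv/= sb (le_trans ta (ltW ts)).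
  by move=> PF; exact: (@filter_ex _ _ (at_right_proper_filter t) _ PF).
- have : \forall s \near t^'-, P s.
    near=> s; have ts : s < t by near: s; exact: nbhs_left_lt.
    have sb : a <= s.
      by near: s; apply: nbhs_left_ge; exact: lt_le_trans ab bt.
    have : s != t -> `[a, b]%classic s -> P s.
      by near: s; exact: cvg_within PP.
    by apply; rewrite ?lt_eqF//= in_itv/= sb (le_trans (ltW ts) tb).
  by move=> PF; exact: (@filter_ex _ _ (at_left_proper_filter t) _ PF).
Unshelve. all: by end_near. Qed.

Variable E : tvsType R.
Implicit Types (A : set R) (u : R -> E).

Lemma derive_onE A u t (l : E) : hausdorff_space E -> ProperFilter (within A t^') ->
  diff_quot u t @ within A t^' --> l -> derive_on A u t = l.
Proof.
move=> hE pA ul; apply: (cvg_unique hE (FF := fmap_proper_filter _ pA) _ ul).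
by apply: (@xgetPex _ 0); exists l.
Qed.

Lemma eq_diff_quot_cvg A u v t (l : E) : A t -> {in A, u =1 v} ->
  diff_quot u t @ within A t^' --> l -> diff_quot v t @ within A t^' --> l.
Proof.
move=> At uv; apply: cvg_trans; apply: near_eq_cvg.
rewrite near_withinE; near=> s => As.
by rewrite /diff_quot !uv// inE.
Unshelve. all: by end_near. Qed.

Lemma derivable_onP A u t : derivable_on A u -> A t ->
  diff_quot u t @ within A t^' --> derive_on A u t.
Proof.
by move=> du At; exact: (xgetPex 0 (du t At)).
Qed.

Lemma derivable_on_continuous A u : derivable_on A u ->
  {within A, continuous u}.
Proof.
move=> du; apply/subspace_continuousP => t At.
have [l ul] := du t At.
have : u t + (s - t) *: diff_quot u t s @[s --> within A t^'] --> u t + 0 *: l.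
  apply: tvs_cvgD; first exact: cvg_cst.
  apply: tvs_cvgZ => //.
  rewrite -[X in _ --> X](subrr t); apply: cvgB; last exact: cvg_cst.
  apply: cvg_within_filter; apply: cvg_within; exact: cvg_id.
(* The limit just obtained ignores [s = t]; that point is supplied by [u t] belonging to each of its
   neighbourhoods. *)
rewrite scale0r addr0 => cu B /= /[dup] /nbhs_singleton But /cu.
rewrite /= !near_simpl/= !near_withinE; apply: filterS => s + As.
have [-> //|st] := eqVneq s t.
rewrite /diff_quot scalerA mulfV ?subr_eq0// scale1r addrC subrK.
by apply.
Qed.

End derivative_on_theory.

(** * Primitives and integrals on a segment *)

Section segment_integrals.
Context (R : realType) (a b : R).
Notation mu := lebesgue_measure.

(** The degenerate case [c = d] is included because the integral formula is also needed at the left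
    endpoint. *)
Lemma FTC2_Rintegral (g F : R -> R) (c d : R) : c <= d ->
  {within `[c, d], continuous g} -> {within `[c, d], continuous F} ->
  (forall t, t \in `]c, d[ -> is_derive t 1 F (g t)) ->
  \int[mu]_(t in `[c, d]) g t = F d - F c.
Proof.
rewrite le_eqVlt => /predU1P[<-|cd] cg cF dF.
  by rewrite set_itv1 Rintegral_set1 subrr.
rewrite /Rintegral (continuous_FTC2 (F := F) cd cg) //.
- have /(continuous_within_itvP _ cd)[_ Fc Fd] := cF.
  by split => // t /dF[].
- by move=> t /dF[dFt <-]; rewrite derive1E.
Qed.

(** Composing [g] with the projection onto the segment extends it continuously to the line.
    Integrating the extension from [a - 1] makes [a] and [b] interior points, so the derivative is
    two-sided there as well. *)
Lemma continuous_primitive (g : R -> R) : a < b ->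
  {within `[a, b], continuous g} -> exists F : R -> R,
    (forall t, t \in `[a, b] -> is_derive t 1 F (g t)) /\
    (forall t, t \in `[a, b] -> \int[mu]_(s in `[a, t]) g s = F t - F a).
Proof.
move=> ab cg; pose clamp x := Num.min b (Num.max a x).
have clampab x : clamp x \in `[a, b].
  by rewrite in_itv/= /clamp le_min ge_min lexx (ltW ab)/= le_max lexx.
have clampK x : x \in `[a, b] -> clamp x = x.
  rewrite in_itv/= => /andP[ax xb].
  by rewrite /clamp max_r// min_r.
have cclamp : continuous clamp.
  move=> x; apply: continuous_min; first exact: cvg_cst.
  by apply: continuous_max; [exact: cvg_cst|exact: cvg_id].
pose h x := g (clamp x).
have ch : continuous h.
  move=> x B /= nB.
  have /subspace_continuousP/(_ _ (clampab x) B nB) := cg.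
  move=> /cclamp hB.
  have : nbhs x [set y : R | `[a, b]%classic (clamp y) -> B (h y)] by exact: hB.
  by apply: filterS => y; apply; exact: clampab.
have [F dF] : exists F : R -> R,
    forall t, t \in `[a, b] -> is_derive t 1 F (g t).
  exists (fun x => \int[mu]_(s in `[a - 1, x]) h s).
  move=> t /[dup] tab; rewrite in_itv/= => /andP[ta tb].
  have [||||dFt Ft] := @continuous_FTC1_closed R h (a - 1) t (b + 1).
  - by rewrite (le_lt_trans tb)// ltrDl.
  - apply: continuous_compact_integrable; first exact: segment_compact.
    exact: continuous_subspaceT.
  - by rewrite (lt_le_trans _ ta)// gtrBl.
  - exact: ch.
  by apply: DeriveDef => //; rewrite -derive1E Ft /h clampK.
exists F; split=> // t tab; move: (tab); rewrite in_itv/= => /andP[ta tb].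
have sub : `[a, t] `<=` `[a, b].
  by move=> x; rewrite /= !in_itv/= => /andP[-> /le_trans ->].
have dFt x : x \in `]a, t[ -> is_derive x 1 F (g x).
  by move=> xat; apply/dF/sub; exact: subset_itv_oo_cc xat.
have cF : {within `[a, t], continuous F}.
  by apply: derivable_within_continuous => x /sub /dF[].
exact: FTC2_Rintegral ta (continuous_subspaceW sub cg) cF dFt.
Qed.

(** [F] is nondecreasing with equal end values, hence constant. This replaces positivity of the
    integral in du Bois-Reymond's argument. *)
Lemma derive_eq_primitive (g F : R -> R) :
  {within `[a, b], continuous F} ->
  (forall t, t \in `]a, b[ -> is_derive t 1 F (g t)) ->
  (forall t, t \in `]a, b[ -> 0 <= g t) -> F a = F b ->
  forall t, t \in `]a, b[ -> g t = 0.
Proof.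
move=> cF dF g0 Fab t tab.
have := tab; rewrite in_itv/= => /andP[ta tb].
have ndF x y : a <= x -> x <= y -> y <= b -> F x <= F y.
  move=> ax xy yb; apply: (@ger0_derive1_ndecr _ F a b) => //.
    by move=> z /dF[].
  by move=> z zab; rewrite derive1E; have [_ ->] := dF z zab; exact: g0.
have Fcst x : x \in `]a, b[ -> F a = F x.
  rewrite in_itv/= => /andP[/ltW ax /ltW xb]; apply/eqP.
  by rewrite eq_le ndF//= Fab ndF.
apply: (is_derive_inj (dF t tab)).
apply: (@near_eq_is_derive _ _ _ (cst (F a))).
near=> x; apply: Fcst; near: x.
by apply: open_nbhs_nbhs; split; [exact: itv_open|exact: tab].
Unshelve. all: by end_near. Qed.

End segment_integrals.

(** * Smooth step functions built from exp(-1/x) *)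

Section smooth_step.
Context (R : realType).
Implicit Types (P : {poly R}) (u v : R -> R) (x z r : R).

(** For a monomial with [n > 0], raise z/n <= 1 + z/n <= exp(z/n) to the power [n]; then sum over
    the coefficients. *)
Lemma horner_le_expR P : exists2 C, 0 <= C &
  forall z, 0 <= z -> `|P.[z]| <= C * expR z.
Proof.
have pow n z : 0 <= z -> z ^+ n <= n%:R ^+ n * expR z.
  move=> z0; case: n => [|n].
    by rewrite !expr0 mul1r -expR0 ler_expR.
  have n0 : 0 < n.+1%:R :> R by rewrite ltr0n.
  have zE : z = n.+1%:R * (z / n.+1%:R) by rewrite mulrC divfK ?gt_eqF.
  rewrite [in leRHS]zE expRM_natl -exprMn.
  rewrite lerXn2r ?nnegrE ?mulr_ge0 ?expR_ge0// -ler_pdivrMl//.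
  by rewrite mulrC (le_trans _ (expR_ge1Dx _))// lerDr.
exists (\sum_(i < size P) `|P`_i| * i%:R ^+ i).
  by apply: sumr_ge0 => i _; rewrite mulr_ge0 ?exprn_ge0.
move=> z z0; rewrite horner_coef (le_trans (ler_norm_sum _ _ _))// mulr_suml.
apply: ler_sum => i _; rewrite normrM -mulrA ler_wpM2l//.
by rewrite ger0_norm ?exprn_ge0// pow.
Qed.

(* [P(1/x) exp(-1/x)] extended by 0: a family closed under differentiation. *)
Definition flat P x : R := if 0 < x then P.[x^-1] * expR (- x^-1) else 0.

Lemma flat_le0 P x : x <= 0 -> flat P x = 0.
Proof. by rewrite /flat ltNge => ->. Qed.

Lemma flat_cvg0 P : flat P z @[z --> (0 : R)] --> (0 : R).
Proof.
(* The extra factor ['X], evaluated at 1/z, yields the linear bound C|z| instead of mere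
   boundedness. *)
have [C C0 CP] := horner_le_expR ('X * P).
have flat_le z : `|flat P z| <= C * `|z|.
  rewrite /flat; case: ifPn => z0; last by rewrite normr0 mulr_ge0.
  have zV : 0 < z^-1 by rewrite invr_gt0.
  have := CP _ (ltW zV); rewrite hornerM hornerX !normrM (gtr0_norm zV).
  rewrite (gtr0_norm z0) (gtr0_norm (expR_gt0 _)) expRN.
  rewrite ler_pdivrMr ?expR_gt0// => h.
  rewrite -(ler_pM2l zV) (le_trans h)//.
  by rewrite [leRHS](_ : _ = C * expR z^-1)//; field; rewrite gt_eqF.
apply/cvgr0Pnorm_lt => e e0; near=> z.
apply: (le_lt_trans (flat_le z)).
have : `|z| < e / (C + 1).
  near: z; apply: (@cvgr0_norm_lt _ _ _ _ _ id); first exact: cvg_id.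
  by rewrite divr_gt0// ltr_wpDl.
rewrite ltr_pdivlMr ?ltr_wpDl// => h; apply: le_lt_trans h.
by rewrite mulrC ler_wpM2l// lerDl.
Unshelve. all: by end_near. Qed.

(** For x > 0 this is the chain rule with (1/x)' = -1/x^2. At 0 the slope function is
    [flat ('X * P)], which tends to 0. *)
Lemma is_derive_flat P x : is_derive x 1 (flat P) (flat ('X^2 * (P - P^`())) x).
Proof.
have [x0|x0|->] := ltgtP x 0.
- rewrite flat_le0 ?ltW//; apply: (@near_eq_is_derive _ _ _ (cst 0)).
  near=> y; rewrite flat_le0//; rewrite ltW//; near: y; exact: lt_nbhsl.
- apply: (@near_eq_is_derive R R R (fun y : R => P.[y^-1] * expR (- y^-1))).
    near=> y; rewrite /flat ifT//; near: y; exact: lt_nbhsr.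
  have dV : is_derive x 1 (fun y : R => y^-1) (- x ^- 2).
    by apply: is_derive_eq (is_deriveV _ _) _; rewrite ?gt_eqF// /GRing.scale/= mulr1.
  have dP : is_derive x 1 (fun y : R => P.[y^-1]) (- x ^- 2 * P^`().[x^-1]).
    apply: is_derive_eq (is_derive1_comp (is_derive_poly P _) dV) _.
    by rewrite mulrC.
  have dN : is_derive x 1 (fun y : R => - y^-1) (- - x ^- 2) by exact: is_deriveN.
  have dE := is_derive1_comp (is_derive_expR _) dN.
  apply: is_derive_eq (is_deriveM dP dE) _.
  rewrite /flat x0 /GRing.scale/= hornerM hornerXn hornerD hornerN exprVn.
  by ring.
- rewrite flat_le0//; apply/is_derive1_caratheodory.
  exists (flat ('X * P)); split.
  + move=> z; rewrite (flat_le0 _ (lexx 0)) !subr0 /flat; case: ifPn => z0.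
      by rewrite hornerM hornerX; field; rewrite gt_eqF.
    by rewrite mul0r.
  + by move=> A /=; rewrite flat_le0//; exact: flat_cvg0.
  + by rewrite flat_le0.
Unshelve. all: by end_near. Qed.

(* Each generator and each operation keeps the derivative in the class, so that
   smoothness follows without a formula for higher derivatives. *)
Inductive smooth_fun : (R -> R) -> Prop :=
| smooth_flat P : smooth_fun (flat P)
| smooth_cst (c : R) : smooth_fun (cst c)
| smooth_affine u (c d : R) : smooth_fun u -> smooth_fun (fun x => u (c * x + d))
| smoothD u v : smooth_fun u -> smooth_fun v -> smooth_fun (fun x => u x + v x)
| smoothM u v : smooth_fun u -> smooth_fun v -> smooth_fun (fun x => u x * v x)
| smoothV u : (forall x, u x != 0) -> smooth_fun u ->
    smooth_fun (fun x => (u x)^-1).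

Lemma is_derive_affine u (c d x w : R) : is_derive (c * x + d) 1 u w ->
  is_derive x 1 (fun y => u (c * y + d)) (c * w).
Proof.
move=> du.
have da : is_derive x 1 (fun y : R => c * y + d) c.
  by apply: is_derive_eq; rewrite addr0 /GRing.scale/= mulr1.
by rewrite mulrC; exact: (@is_derive1_comp _ u (fun y => c * y + d)).
Qed.

Lemma smooth_fun_derive u : smooth_fun u ->
  exists2 v, smooth_fun v & forall x, is_derive x 1 u (v x).
Proof.
elim=> {u} [P|c|u c d _ [u' su' du]|u v _ [u' su' du] _ [v' sv' dv]
  |u v su [u' su' du] sv [v' sv' dv]|u u0 su [u' su' du]].
- by exists (flat ('X^2 * (P - P^`()))); [exact: smooth_flat|exact: is_derive_flat].
- by exists (cst 0); [exact: smooth_cst|move=> x; exact: is_derive_cst].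
- exists (fun x => cst c x * u' (c * x + d)).
    by apply: smoothM; [exact: smooth_cst|exact: smooth_affine].
  by move=> x; exact: is_derive_affine (du _).
- exists (fun x => u' x + v' x); first exact: smoothD.
  by move=> x; exact: is_deriveD.
- exists (fun x => u x * v' x + v x * u' x).
    by apply: smoothD; exact: smoothM.
  by move=> x; exact: is_deriveM.
- exists (fun x => cst (-1) x * ((u x)^-1 * (u x)^-1) * u' x).
    apply: smoothM => //; apply: smoothM; first exact: smooth_cst.
    by apply: smoothM; exact: smoothV.
  move=> x; apply: is_derive_eq (is_deriveV (u0 x) (du x)) _.
  by rewrite /GRing.scale/= mulN1r -invfM -expr2.
Qed.

Lemma smooth_step r : 0 < r -> exists B B' : R -> R,
  [/\ smooth_fun B, forall x, is_derive x 1 B (B' x),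
      (forall x, 0 <= B' x) /\ 0 < B' 0,
      forall x, x <= - r -> B x = 0 &
      (forall x, r <= x -> B x = 1) /\ forall x, r <= `|x| -> B' x = 0].
Proof.
(* [B(x) = u(r+x) / (u(r+x) + u(r-x))] with [u(x) = exp(-1/x)]. *)
move=> r0; pose u := flat 1; pose u' := flat 'X^2.
have du x : is_derive x 1 u (u' x).
  by have := is_derive_flat 1 x; rewrite derivC subr0 mulr1.
have flat_ge0 n x : 0 <= flat 'X^n x.
  rewrite /flat; case: ifPn => // x0.
  by rewrite hornerXn mulr_ge0 ?expR_ge0 ?exprn_ge0 ?invr_ge0 ?ltW.
have flat_gt0 n x : 0 < x -> 0 < flat 'X^n x.
  move=> x0; rewrite /flat x0.
  by rewrite hornerXn mulr_gt0 ?expR_gt0 ?exprn_gt0 ?invr_gt0.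
have u_ge0 : forall x, 0 <= u x by exact: (flat_ge0 0%N).
have u_gt0 : forall x, 0 < x -> 0 < u x by exact: (flat_gt0 0%N).
pose n x := u (1 * x + r); pose m x := u (-1 * x + r).
pose n' x := u' (1 * x + r); pose m' x := u' (-1 * x + r).
(* The arguments r + x and r - x add up to 2r, so at least one is positive. *)
have nm0 x : 0 < n x + m x.
  rewrite /n /m !mul1r mulN1r; have [x0|x0] := leP 0 x.
    by rewrite ltr_pwDl// u_gt0// ltr_wpDl.
  by rewrite ltr_pwDr// u_gt0// ltr_wpDl// oppr_ge0 ltW.
exists (fun x => n x * (n x + m x)^-1).
exists (fun x => (n' x * m x + n x * m' x) / (n x + m x) ^+ 2).
have sn : smooth_fun n by apply: smooth_affine; exact: smooth_flat.
have sm : smooth_fun m by apply: smooth_affine; exact: smooth_flat.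
split.
- apply: smoothM => //; apply: smoothV; last exact: smoothD.
  by move=> x; rewrite gt_eqF.
- move=> x.
  have dn : is_derive x 1 n (1 * n' x) by exact: is_derive_affine.
  have dm : is_derive x 1 m (-1 * m' x) by exact: is_derive_affine.
  have dV := @is_deriveV _ (fun y => n y + m y) x _ 1 (lt0r_neq0 (nm0 x)) (is_deriveD dn dm).
  apply: is_derive_eq (is_deriveM dn dV) _.
  rewrite /GRing.scale/=; field; exact: lt0r_neq0.
- split=> [x|].
    rewrite divr_ge0 ?sqr_ge0// addr_ge0// mulr_ge0//; try exact: u_ge0;
      exact: flat_ge0.
  rewrite divr_gt0 ?exprn_gt0// /n /m /n' /m' !mulr0 !add0r.
  by rewrite addr_gt0// mulr_gt0//; (exact: u_gt0 || exact: flat_gt0).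
- by move=> x xr; rewrite /n /u flat_le0 ?mul0r//; lra.
- split=> [x xr|x].
    have mx : m x = 0 by rewrite /m /u flat_le0//; lra.
    by have := nm0 x; rewrite mx addr0 => nx0; rewrite divff// lt0r_neq0.
  (* Outside the transition zone one of r - x and r + x is nonpositive, and each term of the
     numerator has a factor vanishing there. *)
  rewrite /n' /m' /n /m ler_normr => /orP[xr|xr].
    by rewrite /u /u' !(flat_le0 _ (_ : -1 * x + r <= 0)) ?mulr0 ?addr0 ?mul0r//; lra.
  by rewrite /u /u' !(flat_le0 _ (_ : 1 * x + r <= 0)) ?mul0r ?addr0 ?mul0r//; lra.
Qed.

End smooth_step.

(** * Arithmetic of real functions continuous on a set *)

Section within_continuous_arithmetic.
Context (R : realType) (A : set R).
Implicit Types u v : R -> R.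

Lemma within_continuousB u v : {within A, continuous u} ->
  {within A, continuous v} -> {within A, continuous (fun x => u x - v x)}.
Proof.
move=> /subspace_continuousP cu /subspace_continuousP cv.
by apply/subspace_continuousP => x Ax; apply: cvgB; [exact: cu|exact: cv].
Qed.

Lemma within_continuousD u v : {within A, continuous u} ->
  {within A, continuous v} -> {within A, continuous (fun x => u x + v x)}.
Proof.
move=> /subspace_continuousP cu /subspace_continuousP cv.
by apply/subspace_continuousP => x Ax; apply: cvgD; [exact: cu|exact: cv].
Qed.

Lemma within_continuousM u v : {within A, continuous u} ->
  {within A, continuous v} -> {within A, continuous (fun x => u x * v x)}.
Proof.
move=> /subspace_continuousP cu /subspace_continuousP cv.
by apply/subspace_continuousP => x Ax; apply: cvgM; [exact: cu|exact: cv].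
Qed.

End within_continuous_arithmetic.

(** * The lemma of du Bois-Reymond *)

Section dubois_reymond.
Context (R : realType) (a b : R).

(** As [t] may be an endpoint, the ball is recentred at the midpoint of the part of the segment
    within [e] of [t]; a quarter of its length leaves room on both sides. *)
Lemma within_itv_gt (h : R -> R) (m t : R) : a < b ->
  {within `[a, b], continuous h} -> t \in `[a, b] -> m < h t ->
  exists t' r : R, [/\ 0 < r, a < t' - r, t' + r < b &
    forall x, `|x - t'| < r -> m < h x].
Proof.
move=> ab /subspace_continuousP ch tab mt.
have /nbhs_ballP[e /= e0 he] := ch t tab _ (lt_nbhsr mt).
have := tab; rewrite in_itv/= => /andP[ta tb].
pose lo := Num.max a (t - e); pose hi := Num.min b (t + e).
have [alo elo] : a <= lo /\ t - e <= lo by rewrite /lo !le_max !lexx orbT.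
have [hib ehi] : hi <= b /\ hi <= t + e by rewrite /hi !ge_min !lexx orbT.
have lohi : lo < hi.
  by rewrite /lo /hi lt_min !gt_max; apply/andP; split; apply/andP; split; lra.
exists ((lo + hi) / 2), ((hi - lo) / 4); split; [lra|lra|lra|move=> x].
rewrite ltr_norml => /andP[x1 x2]; apply: he.
  by rewrite /ball/= ltr_norml; apply/andP; split; lra.
by rewrite /= in_itv/=; apply/andP; split; lra.
Qed.

Lemma dubois_reymond (f g F : R -> R) : a < b ->
  {within `[a, b], continuous f} -> {within `[a, b], continuous g} ->
  (forall t, t \in `[a, b] -> is_derive t 1 F (f t)) ->
  (forall phi phi' : R -> R, smooth_fun phi ->
    (forall x : R, is_derive x 1 phi (phi' x)) ->
    (exists c d : R, [/\ a < c, d < b &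
      forall x, x \notin `[c, d] -> phi x = 0]) ->
    \int[lebesgue_measure]_(t in `[a, b]) (f t * phi t + g t * phi' t) = 0) ->
  forall s t, s \in `[a, b] -> t \in `[a, b] -> g s - F s = g t - F t.
Proof.
move=> ab cf cg dF H.
pose h x := g x - F x.
have cF : {within `[a, b], continuous F}.
  by apply: derivable_within_continuous => x /dF[].
have ch : {within `[a, b], continuous h}.
  exact: within_continuousB.
suff hle s t : s \in `[a, b] -> t \in `[a, b] -> h t <= h s.
  by move=> s t sab tab; apply/eqP; rewrite eq_le !hle.
move=> sab tab; rewrite leNgt; apply/negP => /midf_lt[].
set m := (h s + h t) / 2 => sm mt.
have [t1 [r1 [r10 at1 t1b ht1]]] := within_itv_gt ab ch tab mt.
(* Passing to [- h] and [- m] gives an interval on which [h] stays below [m]. *)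
have [||s1 [r2 [r20 as1 s1b hs1]]] :=
    @within_itv_gt (fun x => - h x) (- m) s ab _ sab.
- by move=> x; apply: continuousN; exact: ch.
- by rewrite ltrN2.
have {}hs1 x : `|x - s1| < r2 -> h x < m by move=> /hs1; rewrite ltrN2.
have [B [B' [sB dB [B'0 B'pos] Bl [Br B'out]]]] := smooth_step r10.
have [C [C' [sC dC [C'0 _] Cl [Cr C'out]]]] := smooth_step r20.
(* [phi] steps up where [h > m] and down where [h < m], so [(h - m) phi' >= 0]. *)
pose phi (x : R) := B (1 * x + - t1) + cst (-1) x * C (1 * x + - s1).
pose phi' x := B' (x - t1) - C' (x - s1).
have sphi : smooth_fun phi.
  apply: smoothD; first exact: smooth_affine.
  by apply: smoothM; [exact: smooth_cst|exact: smooth_affine].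
have dphi (x : R) : is_derive x 1 phi (phi' x).
  have d1 : is_derive x 1 (fun y => B (1 * y + - t1)) (1 * B' (1 * x + - t1)).
    exact: is_derive_affine.
  have d2 : is_derive x 1 (fun y => C (1 * y + - s1)) (1 * C' (1 * x + - s1)).
    exact: is_derive_affine.
  apply: is_derive_eq (is_deriveD d1 (is_deriveM (is_derive_cst (-1 : R) x 1) d2)) _.
  by rewrite /GRing.scale/= !mul1r mulr0 addr0 mulN1r.
(* By uniqueness [phi'] is the derivative found in the smooth class, which is again
   differentiable. *)
have cphi' : continuous phi'.
  have [v sv dv] := smooth_fun_derive sphi.
  have -> : phi' = v by apply/funext => x; exact: is_derive_inj (dphi x) (dv x).
  have [w _ dw] := smooth_fun_derive sv.
  move=> x; apply: differentiable_continuous; apply/derivable1_diffP.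
  by have [] := dw x.
have cphi : continuous phi.
  move=> x; apply: differentiable_continuous; apply/derivable1_diffP.
  by have [] := dphi x.
pose c := Num.min (t1 - r1) (s1 - r2); pose d := Num.max (t1 + r1) (s1 + r2).
(* Left of [c] both steps are 0; right of [d] both are 1 and cancel. *)
have phi0 x : x \notin `[c, d] -> phi x = 0.
  rewrite in_itv/= negb_and -!ltNge /c /d lt_min gt_max /phi !mul1r.
  move=> /orP[] /andP[x1 x2].
    by rewrite Bl ?Cl ?mulr0 ?addr0//; lra.
  by rewrite Br ?Cr /cst ?mulN1r ?subrr//; lra.
have ac : a < c by rewrite /c lt_min at1.
have db : d < b by rewrite /d gt_max t1b.
have := H phi phi' sphi dphi (ex_intro _ c (ex_intro _ d (And3 ac db phi0))).
have cfg : {within `[a, b], continuous (fun x => f x * phi x + g x * phi' x)}.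
  apply: within_continuousD; apply: within_continuousM => //;
    exact: continuous_subspaceT.
have [G [dG ->]] := continuous_primitive ab cfg; last first.
  by rewrite in_itv/= lexx ltW.
move=> /eqP; rewrite subr_eq0 => /eqP Gab.
have cG : {within `[a, b], continuous G}.
  by apply: derivable_within_continuous => x /dG[].
(* [K] is a primitive of [(h - m) phi'] with [K a = K b]. *)
pose K x := G x - F x * phi x - m * phi x.
pose k x := (h x - m) * phi' x.
have dK (x : R) : x \in `]a, b[ -> is_derive x 1 K (k x).
  move=> /subset_itv_oo_cc xab.
  apply: is_derive_eq (is_deriveB (is_deriveB (dG x xab)
    (is_deriveM (dF x xab) (dphi x))) (is_deriveZ m (dphi x))) _.
  by rewrite /k /h /GRing.scale/=; ring.
have cK : {within `[a, b], continuous K}.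
  have cphiW : {within `[a, b], continuous phi} by exact: continuous_subspaceT.
  apply: within_continuousB.
    by apply: within_continuousB => //; exact: within_continuousM.
  apply: within_continuousM => //; apply: continuous_subspaceT.
  exact: cst_continuous.
have kB x : 0 <= (h x - m) * B' (x - t1).
  have [xt|xt] := ltP `|x - t1| r1; last by rewrite B'out ?mulr0.
  by rewrite mulr_ge0// subr_ge0 ltW// ht1.
have kC x : 0 <= - ((h x - m) * C' (x - s1)).
  have [xs|xs] := ltP `|x - s1| r2; last by rewrite C'out ?mulr0 ?oppr0.
  by rewrite -mulNr opprB mulr_ge0// subr_ge0 ltW// hs1.
have k0 x : x \in `]a, b[ -> 0 <= k x.
  by move=> _; rewrite /k /phi' mulrBr addr_ge0.
have Kab : K a = K b.
  by rewrite /K !phi0 ?mulr0 ?subr0 ?Gab// in_itv/= negb_and -!ltNge ?ac ?db ?orbT.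
have t1ab : t1 \in `]a, b[ by rewrite in_itv/=; apply/andP; split; lra.
(* The contradiction is at [t1]: there the rising step contributes [(h t1 - m) * B' 0 > 0], and the
   other term is nonnegative. *)
have /eqP := derive_eq_primitive cK dK k0 Kab t1ab.
rewrite gt_eqF// /k /phi' mulrBr ltr_pwDl// subrr mulr_gt0// subr_gt0 ht1//.
by rewrite subrr normr0.
Qed.

End dubois_reymond.

(** * Test curves of the form phi(t) y *)

Section test_curves.
Context (R : realType) (E : frechetType R) (a b : R).
Hypothesis ab : a < b.

Lemma diff_quot_scale (A : set R) (phi : R -> R) (y : E) (t l : R) :
  is_derive t 1 phi l ->
  diff_quot (fun s => phi s *: y) t @ within A t^' --> l *: y.
Proof.
move=> /is_derive_diff_quot dphi.
have -> : diff_quot (fun s => phi s *: y) t =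
    fun s => diff_quot (phi : R -> R^o) t s *: y.
  by apply/funext => s; rewrite /diff_quot -scalerBl scalerA.
apply: tvs_cvgZ; last exact: cvg_cst.
exact: cvg_within_filter.
Qed.

Lemma derive_on_scale (phi phi' : R -> R) (y : E) (t : R) :
  (forall x : R, is_derive x 1 phi (phi' x)) -> t \in `[a, b] ->
  derive_on `[a, b] (fun s => phi s *: y) t = phi' t *: y.
Proof.
move=> dphi tab; apply: derive_onE.
- exact: frechet_hausdorff.
- exact: within_itv_proper.
- exact: diff_quot_scale.
Qed.

Lemma smooth_on_scale (phi : R -> R) (y : E) : smooth_fun phi ->
  smooth_on `[a, b] (fun s => phi s *: y).
Proof.
move=> sphi n.
(* Agreement is asked only on the segment, where limits of difference quotients are unique; the next
   derivative depends on nothing else. *)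
have [psi spsi itE] : exists2 psi, smooth_fun psi &
    {in `[a, b]%classic, (fun s => psi s *: y) =1
      iter n (derive_on `[a, b]) (fun s => phi s *: y)}.
  elim: n => [|n [psi spsi IH]]; first by exists phi.
  have [psi' spsi' dpsi] := smooth_fun_derive spsi.
  exists psi' => // t; rewrite inE => tab; rewrite iterS.
  apply/esym/derive_onE.
  - exact: frechet_hausdorff.
  - exact: within_itv_proper.
  - apply: (eq_diff_quot_cvg tab IH); exact: diff_quot_scale.
move=> t tab; have [psi' _ dpsi] := smooth_fun_derive spsi.
exists (psi' t *: y); apply: (eq_diff_quot_cvg tab itE).
exact: diff_quot_scale.
Qed.

End test_curves.

(** * Pairing a weak-* continuous curve with a curve in [E] *)

Section dual_curves.
Context (R : realType) (E : frechetType R) (a b : R).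
Hypothesis ab : a < b.

Lemma weak_star_bounded (u : R -> dual E) :
  weak_star_continuous `[a, b] u ->
  forall y, exists M : R, forall t, `[a, b]%classic t -> `|u t y| <= M.
Proof.
move=> cu y.
have cuy : {within `[a, b], continuous (fun t => `|u t y|)}.
  have /subspace_continuousP cuy := cu y.
  by apply/subspace_continuousP => t tab; apply: cvg_norm; exact: cuy.
have [c _ hc] := EVT_max (ltW ab) cuy.
by exists `|u c y| => t; exact: hc.
Qed.

(** In [u s (v s - w) + u s w] the first term tends to 0 by equicontinuity at 0, uniformly in [s].
    Banach-Steinhaus enters here. *)
Lemma weak_star_cvg (u : R -> dual E) (v : R -> E) (F : set_system R) (w : E)
    (l : R) : Filter F ->
  weak_star_continuous `[a, b] u -> (\forall s \near F, `[a, b]%classic s) ->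
  v @ F --> w -> u s w @[s --> F] --> l -> u s (v s) @[s --> F] --> l.
Proof.
move=> FF cu abF vw ul.
have -> : (fun s => u s (v s)) = (fun s => u s (v s - w) + u s w).
  by apply/funext => s; rewrite linearB subrK.
rewrite -[l]add0r; apply: cvgD => //.
have vw0 : v s - w @[s --> F] --> (0 : E).
  by rewrite -(subrr w); apply: tvs_cvgD => //; exact: cvg_cst.
apply/cvgr0Pnorm_lt => e e0.
have := vw0 _ (uniform_boundedness (weak_star_bounded cu) e0).
by apply: filterS2 abF => s As; exact.
Qed.

Lemma weak_star_pairing_continuous (u : R -> dual E) (v : R -> E) :
  weak_star_continuous `[a, b] u -> {within `[a, b], continuous v} ->
  {within `[a, b], continuous (fun t => u t (v t))}.
Proof.
move=> cu /subspace_continuousP cv; apply/subspace_continuousP => t tab.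
apply: weak_star_cvg => //; [exact: withinT|exact: cv|].
by have /subspace_continuousP := cu (v t); exact.
Qed.

Lemma weak_star_pairing_derive (f gamma : R -> dual E) (mu : R -> E) (t : R) :
  weak_star_continuous `[a, b] gamma -> t \in `]a, b[ ->
  derivable_on `[a, b] mu ->
  is_derive t 1 (fun s => gamma s (mu t)) (f t (mu t)) ->
  is_derive t 1 (fun s => gamma s (mu s))
    (f t (mu t) + gamma t (derive_on `[a, b] mu t)).
Proof.
move=> cgamma tab dmu /is_derive_diff_quot dg.
have tcc := subset_itv_oo_cc tab.
apply/is_derive_diff_quot.
(* The product rule: first [gamma] varies against the fixed vector [mu t], then [gamma s] is applied
   to the quotient of [mu], a convergent pairing. *)
have -> : diff_quot (fun s => gamma s (mu s) : R^o) t = fun s =>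
    diff_quot (fun s => gamma s (mu t) : R^o) t s + gamma s (diff_quot mu t s).
  apply/funext => s.
  rewrite /diff_quot linearZ/= (linearB (gamma s))/= -scalerDr; congr (_ *: _).
  by rewrite [RHS]addrC addrA subrK.
apply: cvgD => //; rewrite -(within_itv_dnbhs tab).
apply: weak_star_cvg => //; [exact: withinT|exact: derivable_onP|].
apply: cvg_within_filter; apply/continuous_withinNx.
exact: within_continuous_continuous (cgamma _) tab.
Qed.

End dual_curves.

(** * Equivalence of the weak equation, the derivative condition and the integral formula *)

Theorem proposition3p5 (R : realType) (E : frechetType R) (a b : R)
    (f gamma : R -> dual E) (hab : a < b)
    (hf : weak_star_continuous `[a, b] f)
    (hgamma : weak_star_continuous `[a, b] gamma) :
  let vanishing_integral :=
    forall mu : R -> E, smooth_on `[a, b] mu ->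
      supp_on `[a, b] mu `<=` `]a, b[ ->
      \int[lebesgue_measure]_(t in `[a, b])
        (f t (mu t) + gamma t (derive_on `[a, b] mu t)) = 0 in
  let C1_with_derivative :=
    weak_star_C1 `[a, b] gamma /\
    forall (y : E) (t : R), t \in `[a, b] ->
      derive_on `[a, b] (fun s => gamma s y) t = f t y in
  let integral_formula :=
    forall (t : R) (y : E), t \in `[a, b] ->
      gamma t y = gamma a y + \int[lebesgue_measure]_(s in `[a, t]) f s y in
  (vanishing_integral <-> C1_with_derivative) /\
  (C1_with_derivative <-> integral_formula).
Proof.
move=> vanishing_integral C1_with_derivative integral_formula.
have aab : a \in `[a, b] by rewrite in_itv/= lexx ltW.
have bab : b \in `[a, b] by rewrite in_itv/= lexx ltW.
have derive_gamma : C1_with_derivative -> forall (y : E) (t : R),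
    t \in `]a, b[ -> is_derive t 1 (fun s => gamma s y) (f t y).
  move=> [cg1 dg] y t tab; have tcc := subset_itv_oo_cc tab.
  apply/is_derive_diff_quot; rewrite -(within_itv_dnbhs tab) -dg//.
  by apply: derivable_onP => //; case: (cg1 y).
have C1_vanishing : C1_with_derivative -> vanishing_integral.
  move=> hC1 mu smu suppmu.
  have dmu : derivable_on `[a, b] mu by exact: (smu 0%N).
  have cmu := derivable_on_continuous dmu.
  have cmu' : {within `[a, b], continuous (derive_on `[a, b] mu)}.
    by apply: derivable_on_continuous; exact: (smu 1%N).
  have dN t : t \in `]a, b[ -> is_derive t 1 (fun s => gamma s (mu s))
      (f t (mu t) + gamma t (derive_on `[a, b] mu t)).
    by move=> tab; apply: weak_star_pairing_derive => //; exact: derive_gamma.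
  (* An endpoint with [mu t] nonzero would belong to the support, which lies in the open
     interval. *)
  have mu0 t : t \in `[a, b] -> t \notin `]a, b[ -> mu t = 0.
    move=> tab; apply: contraNeq => mut; apply: suppmu.
    by apply: subset_closure.
  have cN := weak_star_pairing_continuous hab hgamma cmu.
  have cI := within_continuousD (weak_star_pairing_continuous hab hf cmu)
    (weak_star_pairing_continuous hab hgamma cmu').
  have -> := FTC2_Rintegral (ltW hab) cI cN dN.
  have mua : mu a = 0 by apply: mu0 => //; rewrite in_itv/= ltxx.
  have mub : mu b = 0 by apply: mu0 => //; rewrite in_itv/= ltxx andbF.
  by rewrite mua mub !linear0 addr0.
have C1_integral : C1_with_derivative -> integral_formula.
  move=> hC1 t y tab; have := tab; rewrite in_itv/= => /andP[ta tb].
  have sub : `[a, t] `<=` `[a, b].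
    by move=> x; rewrite /= !in_itv/= => /andP[-> /le_trans ->].
  have dg x : x \in `]a, t[ -> is_derive x 1 (fun s => gamma s y) (f x y).
    rewrite in_itv/= => /andP[ax xt]; apply: derive_gamma => //.
    by rewrite in_itv/= ax (lt_le_trans xt).
  have -> := FTC2_Rintegral ta (continuous_subspaceW sub (hf y))
    (continuous_subspaceW sub (hgamma y)) dg.
  by rewrite addrC subrK.
have integral_C1 : integral_formula -> C1_with_derivative.
  move=> hI.
  have dg (y : E) (t : R) : t \in `[a, b] ->
      diff_quot (fun s => gamma s y) t @ within `[a, b] t^' --> f t y.
    move=> tab; have [F [dF FI]] := continuous_primitive hab (hf y).
    (* On the segment [gamma s y] is thus a function with two-sided derivatives, and relative
       derivatives see only the segment. *)
    have gE : {in `[a, b]%classic,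
        (fun s => gamma a y + (F s - F a) : R^o) =1 (fun s => gamma s y)}.
      by move=> s; rewrite inE => sab; rewrite (hI s y sab) FI.
    apply: (eq_diff_quot_cvg tab gE); apply: cvg_within_filter.
    apply/is_derive_diff_quot; have dFt := dF t tab.
    apply: is_derive_eq (is_deriveD (is_derive_cst (gamma a y : R) t 1)
      (is_deriveB dFt (is_derive_cst (F a) t 1))) _.
    by rewrite add0r subr0.
  have dgE (y : E) (t : R) : t \in `[a, b] ->
      derive_on `[a, b] (fun s => gamma s y) t = f t y.
    move=> tab; apply: derive_onE; [exact: Rhausdorff| |exact: dg].
    exact: within_itv_proper.
  split=> // y; split=> [t tab|]; first by exists (f t y); exact: dg.
  apply: subspace_eq_continuous (hf y) => t; rewrite inE => tab.
  by rewrite /from_subspace dgE.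
(* This closes the cycle through the integral formula: du Bois-Reymond makes [gamma t y - F t]
   constant, and its value at [a] fixes the constant. *)
have vanishing_integral_formula : vanishing_integral -> integral_formula.
  move=> hV t y tab.
  have [F [dF FI]] := continuous_primitive hab (hf y).
  suff : gamma t y - F t = gamma a y - F a.
    by rewrite FI// => /eqP; rewrite subr_eq => /eqP ->; rewrite addrAC addrA.
  apply: (dubois_reymond hab (hf y) (hgamma y) dF) => //.
  move=> phi phi' sphi dphi [c [d [ac db phi0]]].
  have := hV (fun t => phi t *: y) (smooth_on_scale hab y sphi).
  (* The nonzero points lie in the closed segment from [c] to [d], so taking the closure does not
     leave it. *)
  have suppE : supp_on `[a, b] (fun t => phi t *: y) `<=` `]a, b[.
    apply: (@subset_trans _ `[c, d]); last first.
      by apply: subset_itv; rewrite bnd_simp.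
    rewrite [X in _ `<=` X](_ : _ = closure `[c, d]); last first.
      by apply/closure_id; exact: itv_closed.
    apply: closureS => s [_]; apply: contraPP => /= /negP scd.
    by rewrite phi0// scale0r eqxx.
  move=> /(_ suppE) <-; apply: eq_Rintegral => s; rewrite inE => sab.
  by rewrite (derive_on_scale hab y dphi sab) !linearZ/= mulrC [X in _ + X]mulrC.
by split; split => // /vanishing_integral_formula.
Qed.
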